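(* Suppose that for each task $q\in\mathcal Q$ not all agents are dominating for $q$. Let $\gamma_i^q>0$ for all $i\in\mathcal A$, $q\in\mathcal Q$. Consider the dynamics $$w_i^q(t+1)=\big[w_i^q(t)+\gamma_i^q\,u_i^q(\mathbf w^q(t))\big]_0^1,\qquad i\in\mathcal A,\ q\in\mathcal Q,\ t\in\mathbb Z_{\ge0},$$ with an initial condition $\mathbf W(0)\in[0,1]^{n\times m}$, and let $\mathbf W(t)=(w_i^q(t))$ be the solution trajectory. Then $\lim_{t\to\infty}\mathbf W(t)=\bar{\mathbf W}$ for some $\bar{\mathbf W}\in\mathcal W$, where $\mathcal W$ is the set of equilibrium points of the dynamics.
   Context: $\mathcal A=\{1,\dots,n\}$ is a finite set of agents and $\mathcal Q=\{1,\dots,m\}$ a finite set of tasks. For each $i\in\mathcal A$, $f_i:\mathcal Q\to\mathbb R_{\ge 0}$ is a given function. Agent $i$ is dominating for task $q$ if $f_i(q)\ge f_j(q)$ for all $j\in\mathcal A$. For $x\in\mathbb R$, $[x]_0^1=\max\{0,\min\{x,1\}\}$. For $\mathbf W=(w_i^q)\in[0,1]^{n\times m}$, $\mathbf w^q=(w_i^q)_{i\in\mathcal A}\in[0,1]^n$ is the column of weights for task $q$, and $$u_i^q(\mathbf w^q)=f_i(q)-\max_{j\in\mathcal A\setminus\{i\}}f_j(q)w_j^q .$$ The set of equilibrium points is $$\mathcal W=\big\{\mathbf W\in[0,1]^{n\times m}:\ [w_i^q+\gamma_i^q u_i^q(\mathbf w^q)]_0^1=w_i^q\ \ \forall i\in\mathcal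 A,\ \forall q\in\mathcal Q\big\}.$$ *)

(* Defs.v *)
From HB Require Import structures.
From mathcomp Require Import all_boot all_order all_algebra.
From mathcomp Require Import all_classical all_reals all_analysis.

Set Implicit Arguments.
Unset Strict Implicit.
Unset Printing Implicit Defensive.

Import Order.TTheory GRing.Theory Num.Theory.
Import numFieldNormedType.Exports.

Local Open Scope classical_set_scope.
Local Open Scope ring_scope.

Definition dominating (R : realType) (n m : nat) (f : 'I_n -> 'I_m -> R)
    (i : 'I_n) (q : 'I_m) : Prop :=
  forall j : 'I_n, f j q <= f i q.

Definition clip01 (R : realType) (x : R) : R := Num.max 0 (Num.min x 1).

(* [w] is the column of weights for [q].  Starting the iterated maximum at 0
   does not change it when [n >= 2], [f] is nonnegative and [w] has entries in
   [0, 1]: every term is then nonnegative and there is at least one term.  When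
   some agent is not dominating for [q], necessarily [n >= 2]. *)
Definition utility (R : realType) (n m : nat) (f : 'I_n -> 'I_m -> R)
    (i : 'I_n) (q : 'I_m) (w : 'cV[R]_n) : R :=
  f i q - \big[Num.max/0]_(j < n | j != i) (f j q * w j 0).

Definition unit_box (R : realType) (n m : nat) : set 'M[R]_(n, m) :=
  [set W | forall (i : 'I_n) (q : 'I_m), 0 <= W i q <= 1].

Definition update (R : realType) (n m : nat) (f gamma : 'I_n -> 'I_m -> R)
    (W : 'M[R]_(n, m)) (i : 'I_n) (q : 'I_m) : R :=
  clip01 (W i q + gamma i q * utility f i q (col q W)).

Definition equilibria (R : realType) (n m : nat)
    (f gamma : 'I_n -> 'I_m -> R) : set 'M[R]_(n, m) :=
  [set W | unit_box W /\
           forall (i : 'I_n) (q : 'I_m), update f gamma W i q = W i q].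

(* Main.v *)
Require Import Defs.
From mathcomp Require Import all_boot all_order all_algebra.
From mathcomp Require Import all_classical all_reals all_analysis.
From mathcomp Require Import lra.

Import Order.TTheory GRing.Theory Num.Theory.
Import numFieldNormedType.Exports.

(** The tasks evolve independently, so fix a task [q] and let [M] be the largest
    value [f i q]; since not every agent attains it, [M > 0].

    A dominating agent has nonnegative utility, because every term [f j q * w j]
    is at most [M].  Its weight is therefore nondecreasing and converges.  At
    least one of these limits is 1 ([some_dominating_cvg1]): if all of them
    were below 1, then all products [f j q * w j] would stay below a common
    bound [B < M], so a dominating agent would gain at least
    [gamma * (M - B) > 0] at each step and would reach weight 1.

    Once a dominating agent [k] has weight close to 1, a non-dominating agent [j]
    has utility at most about [f j q - M < 0], so its weight drops by a fixed
    amount per step and becomes 0 in finite time ([nondominating_cvg0]).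

    Hence every entry of the trajectory converges.  The update map is continuous,
    so the limit is one of its fixed points ([limit_equilibrium]), and it lies in
    the box because the update takes values in [[0, 1]]. *)

Local Open Scope classical_set_scope.
Local Open Scope ring_scope.

(** * Scalar sequences driven through the clipping to [[0, 1]] *)

Section Clipping.
Variable R : realType.
Implicit Types (x y c : R) (u g : nat -> R).

Lemma clip01_itv x : 0 <= clip01 x <= 1.
Proof. by rewrite /clip01 le_max lexx ge_max ler01 ge_min lexx orbT. Qed.

Lemma clip01_ge_min x y : x <= y -> Num.min x 1 <= clip01 y.
Proof.
move=> xy; rewrite /clip01 le_max; apply/orP; right.
by rewrite le_min !ge_min xy lexx orbT.
Qed.

Lemma clip01_onem x : clip01 (1 - x) = 1 - clip01 x.
Proof.
rewrite /clip01 /Num.max /Num.min; repeat case: ifPn; rewrite -?leNgt; lra.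
Qed.

(** A drift bounded below by [c > 0] accumulates until the clipping stops it:
    [k] steps after the bound sets in, the value is at least [min (k c) 1]. *)
Lemma clipped_reaches1 u g c :
  (forall t, 0 <= u t <= 1) -> (forall t, u t.+1 = clip01 (u t + g t)) ->
  0 < c -> (\forall t \near \oo, c <= g t) -> \forall t \near \oo, u t = 1.
Proof.
move=> u01 uS c0 [N _ cg].
have grow k : Num.min (c *+ k) 1 <= u (N + k)%N.
  elim: k => [|k IH]; first by rewrite mulr0n ge_min (andP (u01 _)).1.
  rewrite addnS uS; have gk : c <= g (N + k)%N by apply: cg; rewrite /= leq_addr.
  move: IH; rewrite ge_min => /orP[IH|IH].
    by apply: clip01_ge_min; rewrite mulrSr lerD.
  apply: le_trans (clip01_ge_min 1 _ _); first by rewrite minxx ge_min lexx orbT.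
  lra.
(* After [K > 1 / c] steps, [min (K c) 1] is 1. *)
have := archi_boundP (ltW (divr_gt0 ltr01 c0)).
set K := Num.Def.archi_bound _ => cK.
exists (N + K)%N => // t /= NKt.
apply/eqP; rewrite eq_le (andP (u01 t)).2/=.
have Nt : (N <= t)%N by rewrite (leq_trans _ NKt)// leq_addr.
apply: le_trans (_ : Num.min (c *+ (t - N)) 1 <= _); last first.
  by have := grow (t - N)%N; rewrite subnKC.
rewrite le_min lexx andbT -mulr_natl -ler_pdivrMr//.
by rewrite (le_trans (ltW cK))// ler_nat leq_subRL.
Qed.

(** The reflection [x |-> 1 - x] commutes with the clipping and reverses the
    drift. *)
Lemma clipped_reaches0 u g c :
  (forall t, 0 <= u t <= 1) -> (forall t, u t.+1 = clip01 (u t + g t)) ->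
  0 < c -> (\forall t \near \oo, g t <= - c) -> \forall t \near \oo, u t = 0.
Proof.
move=> u01 uS c0 gc.
suff : \forall t \near \oo, 1 - u t = 1.
  by apply: filterS => t; lra.
apply: (@clipped_reaches1 (fun t => 1 - u t) (fun t => - g t) c) => //.
- by move=> t; have := u01 t; lra.
- by move=> t; rewrite uS -clip01_onem; congr clip01; lra.
- by apply: filterS gc => t; lra.
Qed.

Lemma clip01_continuous : continuous (@clip01 R).
Proof.
move=> x; apply: (@continuous_max R R (cst 0) (fun x => Num.min x 1)).
  exact: cvg_cst.
apply: (@continuous_min R R id (cst 1)); [exact: cvg_id | exact: cvg_cst].
Qed.

End Clipping.

(** * Entrywise convergence and fixed points *)

Section Matrices.
Variables (R : realType) (n m : nat).

(** The topology on matrices is the product one: there are finitely many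
    entries, so an entrywise eventual property holds eventually for all. *)
Lemma cvg_coord T (F : set_system T) (FF : Filter F) (W : T -> 'M[R]_(n, m))
    (A : 'M[R]_(n, m)) :
  (forall i q, W t i q @[t --> F] --> A i q) -> W t @[t --> F] --> A.
Proof.
move=> WA B [P AP PB].
have : \forall t \near F, forall i q, P i q (W t i q).
  by apply: filter_forall => i; apply: filter_forall => q; exact: WA (AP i q).
by apply: filterS => t Pt; exact: PB.
Qed.

Lemma update_cvg (f gamma : 'I_n -> 'I_m -> R) i q T (F : set_system T)
    (FF : Filter F) (W : T -> 'M[R]_(n, m)) (A : 'M[R]_(n, m)) :
  (forall j, W t j q @[t --> F] --> A j q) ->
  update f gamma (W t) i q @[t --> F] --> update f gamma A i q.
Proof.
move=> WA; apply: (continuous_cvg _ (@clip01_continuous R _)).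
apply: cvgD; first exact: WA.
apply: cvgM; first exact: cvg_cst.
apply: cvgB; first exact: cvg_cst.
apply: cvg_big => [[x y]|j _].
  by apply: (@continuous_max R _ fst snd); [exact: cvg_fst | exact: cvg_snd].
apply: cvgM; first exact: cvg_cst.
by rewrite mxE; under eq_cvg do rewrite mxE; exact: WA.
Qed.

(** The shifted trajectory converges both to [A] and, by continuity of the
    update, to the update of [A]; the box constraint comes for free, as every
    value of the update is clipped. *)
Lemma limit_equilibrium (f gamma : 'I_n -> 'I_m -> R)
    (W : nat -> 'M[R]_(n, m)) (A : 'M[R]_(n, m)) :
  (forall t i q, W t.+1 i q = update f gamma (W t) i q) ->
  (forall i q, W t i q @[t --> \oo] --> A i q) -> equilibria f gamma A.
Proof.
move=> WS WA.
have fixA i q : update f gamma A i q = A i q.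
  have cvgS : W t.+1 i q @[t --> \oo] --> A i q.
    by rewrite (cvg_shiftS (fun t => W t i q)); exact: WA.
  have cvgU : W t.+1 i q @[t --> \oo] --> update f gamma A i q.
    by under eq_cvg do rewrite WS; exact: update_cvg.
  exact: cvg_unique cvgU cvgS.
by split=> // i q; rewrite -fixA; exact: clip01_itv.
Qed.

End Matrices.

(** * The dynamics of a single task *)

Section Task.
Set Implicit Arguments.
Unset Strict Implicit.
Variables (R : realType) (n m : nat) (f gamma : 'I_n -> 'I_m -> R).
Hypothesis f_ge0 : forall i q, 0 <= f i q.
Hypothesis gamma_gt0 : forall i q, 0 < gamma i q.
Variable W : nat -> 'M[R]_(n, m).
Hypothesis W_box : forall t, unit_box (W t).
Hypothesis W_dynamics : forall t i q, W t.+1 i q = update f gamma (W t) i q.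
Variable q : 'I_m.
Hypothesis not_all_dominating : ~ (forall i, dominating f i q).

Let u t i := utility f i q (col q (W t)).

Lemma utilityE t i : u t i = f i q - \big[Num.max/0]_(j < n | j != i) (f j q * W t j q).
Proof.
by rewrite /u /utility; congr (_ - _); apply: eq_bigr => j _; rewrite mxE.
Qed.

Lemma le_weighted t j : f j q * W t j q <= f j q.
Proof. by rewrite ler_piMr// (andP (W_box t j q)).2. Qed.

Lemma weights_clipped i t : W t.+1 i q = clip01 (W t i q + gamma i q * u t i).
Proof. by rewrite W_dynamics. Qed.

Lemma exists_dominating : exists i, dominating f i q.
Proof.
have /existsNP[i0 _] := not_all_dominating.
case: (arg_maxP (f ^~ q) (isT : xpredT i0)) => i _ maxi.
by exists i => j; exact: maxi.
Qed.

Lemma dominating_gt k j : dominating f k q -> ~ dominating f j q ->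
  f j q < f k q.
Proof.
move=> domk /existsNP[i /negP]; rewrite -ltNge => ji.
exact: lt_le_trans ji (domk i).
Qed.

(** Strict positivity is what turns a weight bounded away from 1 into a product
    [f k q * w] bounded away from [f k q]. *)
Lemma dominating_gt0 k : dominating f k q -> 0 < f k q.
Proof.
move=> domk; have /existsNP[j ndomj] := not_all_dominating.
exact: le_lt_trans (f_ge0 j q) (dominating_gt domk ndomj).
Qed.

(** No weighted competitor exceeds [f i q], so the utility of [i] is
    nonnegative. *)
Lemma dominating_nondecreasing i : dominating f i q ->
  nondecreasing_seq (fun t => W t i q).
Proof.
move=> domi; apply/nondecreasing_seqP => t.
have /andP[_ w1] := W_box t i q.
rewrite weights_clipped -[leLHS](min_l w1).
apply: clip01_ge_min; rewrite lerDl mulr_ge0 ?(ltW (gamma_gt0 _ _))//.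
rewrite utilityE subr_ge0; apply: bigmax_le => // j _.
exact: le_trans (le_weighted t j) (domi j).
Qed.

Lemma dominating_is_cvg i : dominating f i q -> cvgn (fun t => W t i q).
Proof.
move=> domi; apply: nondecreasing_is_cvgn; first exact: dominating_nondecreasing.
by exists 1 => _ [t _ <-]; exact: (andP (W_box t i q)).2.
Qed.

(** If every dominating weight had a limit below 1, monotonicity would keep each
    product [f j q * W t j q] below a bound [b j < f i q] uniform in [t], where
    [i] is dominating; non-dominating agents satisfy this with [b j := f j q].
    The utility of [i] would then be bounded below by a positive constant, so
    its weight would reach 1 after all. *)
Lemma some_dominating_cvg1 :
  exists2 k, dominating f k q & W t k q @[t --> \oo] --> (1 : R).
Proof.
apply: contrapT => no1.
have lim_lt1 k : dominating f k q -> limn (fun t => W t k q) < 1.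
  move=> domk; rewrite lt_neqAle; apply/andP; split.
    apply/eqP => lk1; apply: no1; exists k => //.
    by rewrite -lk1; exact: dominating_is_cvg.
  apply: limr_le; first exact: dominating_is_cvg.
  by apply: nearW => t; exact: (andP (W_box t k q)).2.
have [i domi] := exists_dominating.
have fi0 := dominating_gt0 domi.
have /choice[b bP] (j : 'I_n) :
    exists b, b < f i q /\ forall t, f j q * W t j q <= b.
  have [domj|ndomj] := pselect (dominating f j q); last first.
    by exists (f j q); split; [exact: dominating_gt | move=> t; exact: le_weighted].
  exists (f j q * limn (fun t => W t j q)); split=> [|t].
    apply: lt_le_trans (domi j).
    by rewrite gtr_pMr ?dominating_gt0// lim_lt1.
  apply: ler_wpM2l => //.
  exact: nondecreasing_cvgn_le (dominating_nondecreasing domj)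
    (dominating_is_cvg domj) t.
pose B := \big[Num.max/0]_(j < n) b j.
have Bi : B < f i q by apply: bigmax_lt => // j _; exact: (bP j).1.
have uB t : f i q - B <= u t i.
  rewrite utilityE lerD2l lerN2; apply: bigmax_le => [|j _].
    exact: bigmax_ge_id.
  exact: le_trans ((bP j).2 t) (le_bigmax _ _ j).
have W1 : \forall t \near \oo, W t i q = 1.
  apply: (@clipped_reaches1 R (fun t => W t i q) (fun t => gamma i q * u t i)
    (gamma i q * (f i q - B))) => //.
  - by move=> t; exact: W_box.
  - by rewrite mulr_gt0// subr_gt0.
  - by apply: nearW => t; rewrite ler_pM2l.
by apply: no1; exists i => //; exact: cvg_near_cst.
Qed.

(** The dominating agent [k] whose weight tends to 1 eventually outweighs [j] by
    at least half of the gap [f k q - f j q], a uniform negative drift. *)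
Lemma nondominating_cvg0 j : ~ dominating f j q ->
  W t j q @[t --> \oo] --> (0 : R).
Proof.
move=> ndomj; apply: cvg_near_cst.
have [k domk Wk1] := some_dominating_cvg1.
have jk := dominating_gt domk ndomj.
have kj : k != j by apply/eqP => kj; apply: ndomj; rewrite -kj.
pose c := (f k q - f j q) / 2.
apply: (@clipped_reaches0 R (fun t => W t j q) (fun t => gamma j q * u t j)
  (gamma j q * c)) => //.
- by move=> t; exact: W_box.
- by rewrite mulr_gt0// /c; lra.
have fWk : f k q * W t k q @[t --> \oo] --> f k q.
  by rewrite -[X in _ --> X]mulr1; apply: cvgM => //; exact: cvg_cst.
have : f k q - c < f k q by rewrite /c; lra.
move/(cvgr_gt _ fWk); apply: filterS => t ft.
rewrite -mulrN ler_pM2l// utilityE.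
have : f k q * W t k q <= \big[Num.max/0]_(j0 < n | j0 != j) (f j0 q * W t j0 q).
  exact: (le_bigmax_cond _ (fun j0 => f j0 q * W t j0 q)).
by move: ft; rewrite /c; lra.
Qed.

Lemma weights_is_cvg i : cvgn (fun t => W t i q).
Proof.
have [/dominating_is_cvg//|/nondominating_cvg0 W0] := pselect (dominating f i q).
by apply/cvg_ex; exists 0.
Qed.

End Task.

Theorem theoremV2 (R : realType) (n m : nat) (f gamma : 'I_n -> 'I_m -> R)
    (f_ge0 : forall i q, 0 <= f i q)
    (not_all_dominating : forall q : 'I_m,
       ~ (forall i : 'I_n, dominating f i q))
    (gamma_gt0 : forall i q, 0 < gamma i q)
    (W : nat -> 'M[R]_(n, m))
    (W0_box : unit_box (W 0%N))
    (W_dynamics : forall (t : nat) (i : 'I_n) (q : 'I_m),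
       W t.+1 i q = update f gamma (W t) i q) :
  exists2 Wbar : 'M[R]_(n, m),
    equilibria f gamma Wbar & W t @[t --> \oo] --> Wbar.
Proof.
have W_box t : unit_box (W t).
  by case: t => [//|t] i q; rewrite W_dynamics; exact: clip01_itv.
pose Wbar : 'M[R]_(n, m) := \matrix_(i, q) limn (fun t => W t i q).
have Wcvg i q : W t i q @[t --> \oo] --> Wbar i q.
  rewrite mxE; exact: (weights_is_cvg f_ge0 gamma_gt0 W_box W_dynamics
    (not_all_dominating q)).
exists Wbar; first exact: limit_equilibrium W_dynamics Wcvg.
exact: cvg_coord.
Qed.
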